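(* Let $\mathbb{k}$ be a field, $R$ be a finitely generated $\mathbb{k}$-domain and $r$ be the transcendence degree of $\mathrm{Quot}(R)$ over $\mathbb{k}$. Then there is a valuation $\nu : \mathrm{Quot}(R) \rightarrow \mathbb{Z}^r$ (with respect to some total order on $\mathbb{Z}^r$ compatible with addition) that satisfies the following conditions: (i) $\nu(\alpha) = 0$ for all nonzero $\alpha \in \mathbb{k} \subset \mathrm{Quot}(R)$. (ii) $\nu$ is faithful. (iii) $\nu$ has leaves of bounded dimension.
   Context: A $\mathbb{k}$-domain is a $\mathbb{k}$-algebra that is an integral domain, and $\mathrm{Quot}(R)$ is its field of fractions. An order on $\mathbb{Z}^r$ is compatible with addition if $\mathbf{n}<\mathbf{m}$ implies $\mathbf{n}+\mathbf{p}<\mathbf{m}+\mathbf{p}$ for all $\mathbf{n},\mathbf{m},\mathbf{p}\in\mathbb{Z}^r$. Valuations are defined on nonzero elements, with $\nu(0)=\infty$. $\nu$ is faithful if its set of values on $\mathrm{Quot}(R)\setminus\{0\}$ is all of $\mathbb{Z}^r$. For $\mathbf{n}\in\mathbb{Z}^r$ let $K_{\mathbf{n}}=\{f\in\mathrm{Quot}(R):\nu(f)\ge\mathbf{n}\}$ and $K_{\mathbf{n}}^+=\{f\in\mathrm{Quot}(R):\nu(f)>\mathbf{n}\}$; the leaf with value $\mathbf{n}$ is the $\mathbb{k}$-vector space $L_{\mathbf{n}}=K_{\mathbf{n}}/K_{\mathbf{n}}^+$. $\nu$ has leaves of bounded dimension if $\sup_{\mathbf{n}\in\mathbb{Z}^r}\dim_{\mathbb{k}}(L_{\mathbf{n}})<\infty$.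 *)

(* Defs.v *)
From HB Require Import structures.
From mathcomp Require Import all_boot all_order all_algebra.
From mathcomp Require Import ring_quotient generic_quotient fraction.
From mathcomp.multinomials Require Import mpoly.

Set Implicit Arguments.
Unset Strict Implicit.
Unset Printing Implicit Defensive.

Import GRing.Theory.
Local Open Scope ring_scope.
Local Open Scope quotient_scope.

#[short(type="domainAlgType")]
HB.structure Definition DomainAlgebra (k : nzRingType) :=
  {R of GRing.IntegralDomain R & GRing.ComUnitAlgebra k R}.

(** [{fraction R}] as a [k]-algebra, through [k -> R -> {fraction R}]. *)
Section FractionAlgebra.
Variables (k : fieldType) (R : domainAlgType k).
Implicit Types (c d : k) (f g : {fraction R}).

Definition fracscale c f : {fraction R} := tofrac (c%:A : R) * f.

Lemma fracscaleA c d f : fracscale c (fracscale d f) = fracscale (c * d) f.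
Proof. by rewrite /fracscale mulrA -rmorphM /= -in_algE -rmorphM. Qed.

Lemma fracscale1 : left_id 1 fracscale.
Proof. by move=> f; rewrite /fracscale scale1r rmorph1 mul1r. Qed.

Lemma fracscaleDr : right_distributive fracscale +%R.
Proof. by move=> c f g; rewrite /fracscale mulrDr. Qed.

Lemma fracscaleDl f : {morph fracscale^~ f : c d / c + d}.
Proof. by move=> c d; rewrite /fracscale scalerDl rmorphD mulrDl. Qed.

HB.instance Definition _ := GRing.Zmodule_isLmodule.Build k {fraction R}
  fracscaleA fracscale1 fracscaleDr fracscaleDl.

Lemma fracscaleAl c f g : c *: (f * g) = c *: f * g.
Proof. exact: mulrA. Qed.

HB.instance Definition _ :=
  GRing.Lmodule_isLalgebra.Build k {fraction R} fracscaleAl.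

Lemma fracscaleAr c f g : c *: (f * g) = f * (c *: g).
Proof. exact: mulrCA. Qed.

HB.instance Definition _ :=
  GRing.Lalgebra_isAlgebra.Build k {fraction R} fracscaleAr.

End FractionAlgebra.

Definition finitely_generated (k : fieldType) (R : comAlgType k) : Prop :=
  exists (m : nat) (a : 'I_m -> R),
    forall x : R, exists p : {mpoly k[m]}, x = mmap (in_alg R) a p.

Definition alg_indep (k : fieldType) (A : comAlgType k) (m : nat)
    (z : 'I_m -> A) : Prop :=
  forall p : {mpoly k[m]}, mmap (in_alg A) z p = 0 -> p = 0.

Definition has_trdeg (k : fieldType) (A : comAlgType k) (r : nat) : Prop :=
  (exists z : 'I_r -> A, alg_indep z) /\
  (forall (m : nat) (z : 'I_m -> A), alg_indep z -> (m <= r)%N).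

Definition lin_indep (k : fieldType) (V : lmodType k) (d : nat)
    (b : 'I_d -> V) : Prop :=
  forall c : 'I_d -> k, \sum_i c i *: b i = 0 -> forall i, c i = 0.

Definition spanning (k : fieldType) (V : lmodType k) (d : nat)
    (b : 'I_d -> V) : Prop :=
  forall v : V, exists c : 'I_d -> k, v = \sum_i c i *: b i.

(** [V] is not assumed to be a [vectType]: it may be infinite-dimensional. *)
Definition has_dim (k : fieldType) (V : lmodType k) (d : nat) : Prop :=
  exists b : 'I_d -> V, lin_indep b /\ spanning b.

(** The library only provides the additive group [V / S]. *)
Section QuotientModule.
Variables (k : fieldType) (V : lmodType k) (S : {pred V}).
Hypothesis S_submod : submod_closed S.

Definition submod_pred of submod_closed S : {pred V} := S.

HB.instance Definition _ :=
  GRing.isSubmodClosed.Build k V (submod_pred S_submod) S_submod.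

Definition lmod_quot := Quotient.quot (submod_pred S_submod).

HB.instance Definition _ := ZmodQuotient.on lmod_quot.

Definition quot_scale (c : k) (x : lmod_quot) : lmod_quot :=
  \pi_lmod_quot (c *: repr x).

Lemma pi_scale (c : k) (v : V) :
  quot_scale c (\pi_lmod_quot v) = \pi_lmod_quot (c *: v).
Proof.
apply/eqP; rewrite -[_ == _]Quotient.idealrBE -scalerBr rpredZ //.
by rewrite Quotient.idealrBE reprK.
Qed.

Lemma lmod_quotP (x : lmod_quot) : {v : V | x = \pi_lmod_quot v}.
Proof. by exists (repr x); rewrite reprK. Qed.

Lemma quot_scaleA c d x : quot_scale c (quot_scale d x) = quot_scale (c * d) x.
Proof. by have [v ->] := lmod_quotP x; rewrite !pi_scale scalerA. Qed.

Lemma quot_scale1 : left_id 1 quot_scale.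
Proof. by move=> x; have [v ->] := lmod_quotP x; rewrite pi_scale scale1r. Qed.

Lemma quot_scaleDr : right_distributive quot_scale +%R.
Proof.
move=> c x y; have [v ->] := lmod_quotP x; have [w ->] := lmod_quotP y.
by rewrite -raddfD !pi_scale scalerDr raddfD.
Qed.

Lemma quot_scaleDl x : {morph quot_scale^~ x : c d / c + d}.
Proof.
move=> c d /=; have [v ->] := lmod_quotP x.
by rewrite !pi_scale scalerDl raddfD.
Qed.

HB.instance Definition _ := GRing.Zmodule_isLmodule.Build k lmod_quot
  quot_scaleA quot_scale1 quot_scaleDr quot_scaleDl.

End QuotientModule.

Record group_order (r : nat) := GroupOrder {
  ole :> rel 'rV[int]_r;
  ole_refl : reflexive ole;
  ole_anti : antisymmetric ole;
  ole_trans : transitive ole;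
  ole_total : total ole;
  olt_add2r : forall n m p : 'rV_r,
    (n != m) && ole n m -> (n + p != m + p) && ole (n + p) (m + p)
}.

Definition olt (r : nat) (o : group_order r) : rel 'rV[int]_r :=
  fun n m => (n != m) && o n m.

Definition omin (r : nat) (o : group_order r) (n m : 'rV[int]_r) :=
  if o n m then n else m.

(** The value at [0], which should be infinite, is irrelevant: every use of a
    valuation treats [0] separately. *)
Record valuation (F : fieldType) (r : nat) (o : group_order r) := Valuation {
  vval :> F -> 'rV[int]_r;
  vvalM : forall f g : F, f != 0 -> g != 0 -> vval (f * g) = vval f + vval g;
  vvalD : forall f g : F, f != 0 -> g != 0 -> f + g != 0 ->
    o (omin o (vval f) (vval g)) (vval (f + g))
}.

Definition faithful (F : fieldType) (r : nat) (o : group_order r)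
    (nu : valuation F o) : Prop :=
  forall n : 'rV[int]_r, exists2 f : F, f != 0 & nu f = n.

Definition trivial_on_scalars (k : fieldType) (R : domainAlgType k) (r : nat)
    (o : group_order r) (nu : valuation {fraction R} o) : Prop :=
  forall a : k, a != 0 -> nu a%:A = 0.

(** [nu_k] is what makes the sets below [k]-subspaces; they take it as an unused
    argument so that the [k]-module structures can be inferred. *)
Section Leaves.
Variables (k : fieldType) (R : domainAlgType k) (r : nat) (o : group_order r).
Variables (nu : valuation {fraction R} o) (nu_k : trivial_on_scalars nu).
Variable n : 'rV[int]_r.

Definition Kge of trivial_on_scalars nu : {pred {fraction R}} :=
  fun f => (f == 0) || o n (nu f).

Definition Kgt of trivial_on_scalars nu : {pred {fraction R}} :=
  fun f => (f == 0) || olt o n (nu f).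

Lemma vvalZ (c : k) (f : {fraction R}) : c != 0 -> f != 0 -> nu (c *: f) = nu f.
Proof.
move=> c0 f0; rewrite -[f in LHS]mul1r scalerAl vvalM ?nu_k ?add0r //.
by rewrite scaler_eq0 negb_or c0 oner_eq0.
Qed.

Lemma olt_ole_trans m p q : olt o p m -> o m q -> olt o p q.
Proof.
move=> /andP[npm opm] omq; rewrite /olt (ole_trans opm omq) andbT.
by apply: contra_neq npm => epq; apply: (@ole_anti _ o); rewrite opm epq omq.
Qed.

Lemma Kge_submod : submod_closed (Kge nu_k).
Proof.
split=> [|c f g]; rewrite !unfold_in ?eqxx //.
have [->|c0] := eqVneq c 0; first by rewrite scale0r add0r.
have [->|f0 /= nf] := eqVneq f 0; first by rewrite scaler0 add0r.
have cf0 : c *: f != 0 by rewrite scaler_eq0 negb_or c0.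
have [->|g0 /= ng] := eqVneq g 0; first by rewrite addr0 vvalZ // nf orbT.
have [//|cfg0 /=] := eqVneq (c *: f + g) 0.
apply: (ole_trans _ (vvalD nu cf0 g0 cfg0)).
by rewrite vvalZ // /omin; case: ifP.
Qed.

HB.instance Definition _ :=
  GRing.isSubmodClosed.Build k {fraction R} (Kge nu_k) Kge_submod.

Record Kspace := KSpace { Kelt : {fraction R}; Kelt_in : Kelt \in Kge nu_k }.

HB.instance Definition _ := [isSub for Kelt].
HB.instance Definition _ := [Choice of Kspace by <:].
HB.instance Definition _ := [SubChoice_isSubLmodule of Kspace by <:].

Definition Kspace_gt : {pred Kspace} := fun f => Kelt f \in Kgt nu_k.

Lemma Kspace_gt_submod : submod_closed Kspace_gt.
Proof.
split=> [|c [f ?] [g ?]]; rewrite !unfold_in /= ?eqxx //.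
have [->|c0] := eqVneq c 0; first by rewrite scale0r add0r.
have [->|f0 /= nf] := eqVneq f 0; first by rewrite scaler0 add0r.
have cf0 : c *: f != 0 by rewrite scaler_eq0 negb_or c0.
have [->|g0 /= ng] := eqVneq g 0; first by rewrite addr0 vvalZ // nf orbT.
have [//|cfg0 /=] := eqVneq (c *: f + g) 0.
apply: (olt_ole_trans _ (vvalD nu cf0 g0 cfg0)).
by rewrite vvalZ // /omin; case: ifP.
Qed.

Definition leaf : lmodType k := lmod_quot Kspace_gt_submod.

End Leaves.

Definition bounded_leaves (k : fieldType) (R : domainAlgType k) (r : nat)
    (o : group_order r) (nu : valuation {fraction R} o)
    (nu_k : trivial_on_scalars nu) : Prop :=
  exists D : nat, forall n : 'rV[int]_r,
    exists2 d : nat, (d <= D)%N & has_dim (leaf nu_k n) d.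

(* Main.v *)
Require Import Defs.
From HB Require Import structures.
From mathcomp Require Import all_boot all_order all_algebra fraction.
From mathcomp Require Import ring_quotient generic_quotient.
From mathcomp Require Import boolp classical_sets.
From mathcomp Require Import mxpoly ring zify.
From mathcomp.multinomials Require Import mpoly.

Set Implicit Arguments.
Unset Strict Implicit.
Unset Printing Implicit Defensive.

Import Order.TTheory GRing.Theory Num.Theory.
Local Open Scope ring_scope.

(** Let [F] be the fraction field of [R] and [z] a transcendence basis of [F]
    over [k], so that [F] is algebraic over the rational function field
    [K = k(z)].

    On [K], minus the exponent of the leading monomial for the degree
    lexicographic order is a valuation with value group [Z^r] and residue field
    [k] ([monomial_valuation]).  It has to be extended to [F].

    Since [R] is finitely generated, [F] has finite rank [N] over [K]: the
    products of powers of the generators, with bounded exponents, span a space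
    which multiplication by any element of [R] preserves, and any [N + 1]
    elements of [F] have a common denominator in [R]
    ([finitely_generated_finite_rank]).

    A valuation ring of [K] is the trace of a valuation ring [O] of [F]
    ([valuation_ring_extension], a form of Chevalley's theorem).  Zorn's lemma
    is applied to the candidates for its maximal ideal: the additive subgroups
    of [F] that are closed under products, stable under the valuation ring of
    [K], contain the maximal ideal of the latter and avoid 1.  The ring [O]
    consists of the multipliers of a maximal candidate [I]: when [x] is not a
    multiplier, the strictly larger [I[x]] contains 1, and this cannot happen
    for both [x] and its inverse.

    The value group of [O] is again isomorphic to [Z^r]
    ([value_map_extension]).  In a relation between the powers 1, f, ..., f^N
    over [K] two terms have the same value, whence f^(N!) has the value of an
    element of [K].  Mapping [f] to that value embeds the value group of [O]
    into [Z^r], as a subgroup that contains [N! Z^r] and hence has a basis of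
    [r] vectors ([lattice_basis]).  The order on [Z^r] is carried over from the
    divisibility relation of [O] ([valuation_of_ring]); the coordinates in the
    basis are the valuation sought, and are onto [Z^r] by construction.

    Finally a leaf has dimension at most [N]: dividing a relation over [K]
    between [N + 1] elements of one value by its coefficient of least value and
    passing to residues in [k] gives a nontrivial relation in the leaf
    ([residual_relation]). *)

(** * Valuation rings of a field *)

Record valuation_ring (F : fieldType) := ValuationRing {
  vring :> {pred F};
  vring_closed : subring_closed vring;
  vring_total : forall x, (x \in vring) || (x^-1 \in vring)
}.

HB.instance Definition _ (F : fieldType) (O : valuation_ring F) :=
  GRing.isSubringClosed.Build F (vring O) (vring_closed O).

(** The maximal ideal: zero and the elements whose inverse is not in the ring.
    Zero is singled out since its inverse is zero. *)
Definition vmax (F : fieldType) (O : valuation_ring F) : {pred F} :=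
  fun x => (x == 0) || (x^-1 \notin O).

Section ValuationRingTheory.
Variables (F : fieldType) (O : valuation_ring F).
Implicit Types x y a : F.

Lemma vmaxE x : (x \in vmax O) = (x == 0) || (x^-1 \notin O).
Proof. by []. Qed.

Lemma vmax_vring x : x \in vmax O -> x \in O.
Proof.
rewrite vmaxE => /orP[/eqP->|]; first exact: rpred0.
by have /orP[//|->] := vring_total O x.
Qed.

Lemma vmaxM a x : a \in O -> x \in vmax O -> a * x \in vmax O.
Proof.
rewrite !vmaxE => aO; have [->|x0 /= xV] := eqVneq x 0.
  by rewrite mulr0 eqxx.
have [->|a0] := eqVneq a 0; first by rewrite mul0r eqxx.
rewrite mulf_eq0 (negPf a0) (negPf x0) /=; apply: contra xV => axV.
by rewrite (_ : x^-1 = a * (a * x)^-1) ?rpredM // invfM mulVKf.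
Qed.

Lemma vmax_zmod_closed : zmod_closed (vmax O).
Proof.
split=> [|x y xm ym]; first by rewrite vmaxE eqxx.
have [->|x0] := eqVneq x 0.
  by rewrite sub0r -mulN1r; apply: vmaxM => //; rewrite rpredN rpred1.
have [->|y0] := eqVneq y 0; first by rewrite subr0.
have /orP[xy|xy] := vring_total O (x / y).
  rewrite (_ : x - y = (x / y - 1) * y).
    by rewrite vmaxM // rpredB ?rpred1.
  by rewrite mulrBl mul1r divfK.
rewrite (_ : x - y = (1 - (x / y)^-1) * x).
  by rewrite vmaxM // rpredB ?rpred1 // invf_div.
by rewrite invfM invrK mulrBl mul1r mulrAC mulVf ?mul1r.
Qed.

HB.instance Definition _ :=
  GRing.isZmodClosed.Build F (vmax O) vmax_zmod_closed.

Lemma vmax1 : 1 \in vmax O = false.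
Proof. by rewrite vmaxE oner_eq0 invr1 rpred1. Qed.

Lemma least_value (I : finType) (g : I -> F) (i0 : I) : g i0 != 0 ->
  exists2 j, g j != 0 & forall i, g i / g j \in O.
Proof.
move=> gi0.
suff [j gj gjP] : exists2 j, g j != 0 &
    forall i, i \in enum I -> g i / g j \in O.
  by exists j => // i; rewrite gjP ?mem_enum.
elim: (enum I) => [|i s [j gj gjP]]; first by exists i0.
have /orP[ij|ij] := vring_total O (g i / g j).
  by exists j => // l; rewrite inE => /predU1P[->|/gjP].
have [gi|gi] := eqVneq (g i) 0.
  exists j => // l; rewrite inE => /predU1P[->|/gjP//].
  by rewrite gi mul0r rpred0.
exists i => // l; rewrite inE => /predU1P[->|ls].
  by rewrite divff ?rpred1.
rewrite (_ : g l / g i = (g l / g j) * (g i / g j)^-1).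
  by rewrite rpredM ?gjP.
by rewrite invf_div mulrA mulfVK.
Qed.

(** Terms of pairwise distinct values cannot cancel: after division by the term
    of least value, one term is 1 and the others lie in the maximal ideal. *)
Lemma sum0_equal_values (I : finType) (g : I -> F) (i0 : I) :
    g i0 != 0 -> \sum_i g i = 0 ->
  exists i j,
    [/\ i != j, g i != 0, g j != 0, g i / g j \in O & g j / g i \in O].
Proof.
move=> gi0 g0; have [j gj gjP] := least_value gi0.
apply: contrapT => nij; suff: 1 \in vmax O by rewrite vmax1.
rewrite -(divff gj) -[X in X / _]opprK; rewrite (bigD1 j) //= in g0.
rewrite (addr0_eq g0) mulNr rpredN mulr_suml rpred_sum // => i ij.
rewrite vmaxE; case: eqVneq => //= gij; apply/negP => gijV.
have gi : g i != 0 by apply: contra_neq gij => ->; rewrite mul0r.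
by apply: nij; exists i, j; split; rewrite ?gjP // -invf_div.
Qed.

(** Valuation rings are integrally closed; this is the case of roots. *)
Lemma vring_expV x n : (0 < n)%N -> x ^+ n \in O -> x \in O.
Proof.
case: n => // n _ xn; have /orP[//|xV] := vring_total O x.
have [->|x0] := eqVneq x 0; first exact: rpred0.
rewrite (_ : x = x ^+ n.+1 * x^-1 ^+ n).
  by rewrite rpredM // rpredX.
by rewrite exprSr mulrAC -exprMn divff // expr1n mul1r.
Qed.

End ValuationRingTheory.

Definition vunit (F : fieldType) (O : valuation_ring F) : {pred F} :=
  fun x => (x \in O) && (x^-1 \in O).

Section Units.
Variables (F : fieldType) (O : valuation_ring F).
Implicit Types x y : F.

Lemma vunitE x : (x \in vunit O) = (x \in O) && (x^-1 \in O).
Proof. by []. Qed.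

Lemma vunit1 : 1 \in vunit O.
Proof. by rewrite vunitE invr1 rpred1. Qed.

Lemma vunitV x : (x^-1 \in vunit O) = (x \in vunit O).
Proof. by rewrite !vunitE invrK andbC. Qed.

Lemma vunitM x y : x \in vunit O -> y \in vunit O -> x * y \in vunit O.
Proof.
by rewrite !vunitE invfM => /andP[xO xVO] /andP[yO yVO]; rewrite !rpredM.
Qed.

Lemma vunitX x n : x \in vunit O -> x ^+ n \in vunit O.
Proof. by rewrite !vunitE -exprVn => /andP[xO xVO]; rewrite !rpredX. Qed.

Lemma vunit_expV x n : (0 < n)%N -> x ^+ n \in vunit O -> x \in vunit O.
Proof.
move=> n0; rewrite !vunitE -exprVn => /andP[xO xVO].
by rewrite (vring_expV n0 xO) (vring_expV n0 xVO).
Qed.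

End Units.

(** * Extension of valuation rings *)

Section Chevalley.
Variables (F : fieldType) (A0 I0 : {pred F}).

(** The candidates for the maximal ideal of the valuation ring sought, itself
    recovered as the set of [x] with [x I] contained in [I]. *)
Let good (I : set F) : Prop :=
  [/\ forall x, x \in I0 -> I x,
      forall x y, I x -> I y -> I (x - y),
      forall x y, I x -> I y -> I (x * y),
      forall a x, a \in A0 -> I x -> I (a * x)
    & ~ I 1].

Hypothesis I0_sub : zmod_closed I0.
Hypothesis I0_mul : forall x y, x \in I0 -> y \in I0 -> x * y \in I0.
Hypothesis I0_A0 : forall a x, a \in A0 -> x \in I0 -> a * x \in I0.
Hypothesis I0_1 : 1 \notin I0.

Let good_maximal : exists2 I, good I & forall J, good J ->
  (forall x, I x -> J x) -> forall x, J x -> I x.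
Proof.
have good0 : good [set x | x \in I0]%classic.
  by split=> //= [x y xI yI|]; [exact: I0_sub.2 | exact/negP].
(* The empty set is admitted so that the empty chain has an upper bound. *)
have [FF FFP FFt|I [PI maxI]] :=
  @Zorn_bigcup F (fun X => X = set0 \/ good X)%classic.
  have [[X0 FX0 gX0]|nog] := EM (exists2 X, FF X & good X); last first.
    left; apply/seteqP; split=> // x [X FX Xx].
    by case: (FFP _ FX) Xx => [->|gX _] //; case: nog; exists X.
  right.
  have two x y : (\bigcup_(X in FF) X)%classic x ->
      (\bigcup_(X in FF) X)%classic y ->
      exists X, [/\ FF X, good X, X x & X y].
    move=> [X FX Xx] [Y FY Yy].
    have good_of Z z : FF Z -> Z z -> good Z.
      by move=> FZ Zz; case: (FFP _ FZ) Zz => [->|].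
    have [XY|YX] := FFt _ _ FX FY.
      by exists Y; split=> //; [exact: good_of FY Yy | exact: XY].
    by exists X; split=> //; [exact: good_of FX Xx | exact: YX].
  split=> [x xI0|x y Ux Uy|x y Ux Uy|a x aA Ux|U1].
  - by exists X0 => //; case: gX0 => + _ _ _ _; exact.
  - have [X [FX gX Xx Xy]] := two _ _ Ux Uy.
    by exists X => //; case: gX => _ + _ _ _; exact.
  - have [X [FX gX Xx Xy]] := two _ _ Ux Uy.
    by exists X => //; case: gX => _ _ + _ _; exact.
  - have [X [FX gX Xx _]] := two _ _ Ux Ux.
    by exists X => //; case: gX => _ _ _ + _; exact.
  - by have [X [FX gX X1 _]] := two _ _ U1 U1; case: gX.
have gI : good I.
  case: PI => // I_0; case: (maxI _ _ (or_intror good0)).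
  rewrite I_0; split=> // /(_ 0) /=; apply; exact: I0_sub.1.
exists I => // J gJ IJ x Jx; apply: contrapT => nIx.
by apply: (maxI J); [split=> // /(_ x Jx) | right].
Qed.

(** 1 lies in [I[x]]; the bound [n] on the degree is what decreases in the
    proof below. *)
Let unit_expr (I : set F) x n : Prop :=
  exists2 c : nat -> F, (forall i, I (c i)) & 1 = \sum_(i < n) c i * x ^+ i.

(** With [A] the set of multipliers of a maximal candidate [I], an [x] such that
    neither [x] nor its inverse is in [A] would satisfy 1 = p(x) = q(1/x) for
    polynomials [p] and [q] over [I]; such relations can be shortened until
    nothing is left of them. *)
Theorem chevalley : exists O : valuation_ring F,
  (forall a, a \in A0 -> a \in O) /\ (forall x, x \in I0 -> x \in vmax O).
Proof.
have [I gI maxI] := good_maximal.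
case: (gI) => I0I IB IM IA I1.
have I_0 : I 0 by apply: I0I; exact: I0_sub.1.
have IN x : I x -> I (- x) by rewrite -sub0r; exact: IB.
have ID x y : I x -> I y -> I (x + y).
  by move=> Ix Iy; rewrite -[y]opprK; apply/IB/IN.
have Isum m (f : 'I_m -> F) : (forall i, I (f i)) -> I (\sum_i f i).
  by move=> If; elim/big_ind: _.
pose A x := forall i, I i -> I (x * i).
have AI x : I x -> A x by move=> Ix i; exact: IM.
have A1 : A 1 by move=> i; rewrite mul1r.
have AB x y : A x -> A y -> A (x - y).
  by move=> Ax Ay i Ii; rewrite mulrBl; apply: IB; [exact: Ax | exact: Ay].
have AM x y : A x -> A y -> A (x * y).
  by move=> Ax Ay i Ii; rewrite -mulrA; apply/Ax/Ay.
(* By maximality, x I is contained in I as soon as 1 is not in I[x]. *)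
have A_of_nexpr x : (forall n, ~ unit_expr I x n) -> A x.
  move=> nx; pose J y := exists2 p : {poly F}, (forall i, I p`_i) & y = p.[x].
  have IJ y : I y -> J y.
    move=> Iy; exists y%:P; last by rewrite hornerC.
    by move=> i; rewrite coefC; case: ifP.
  have gJ : good J.
    split=> [y yI0|_ _ [p Ip ->] [q Iq ->]|_ _ [p Ip ->] [q Iq ->]|
      a _ aA [p Ip ->]|].
    - exact/IJ/I0I.
    - exists (p - q); last by rewrite hornerD hornerN.
      by move=> i; rewrite coefB; exact: IB.
    - exists (p * q); rewrite ?hornerM // => i; rewrite coefM.
      by apply: Isum => j; exact: IM.
    - by exists (a *: p); rewrite ?hornerZ // => i; rewrite coefZ; exact: IA.
    - move=> [p Ip]; rewrite horner_coef => p1.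
      by apply: (nx (size p)); exists (fun i => p`_i).
  move=> i Ii; apply: (maxI J gJ IJ); exists (i *: 'X).
    by move=> j; rewrite coefZ coefX; case: eqP; rewrite ?mulr1 ?mulr0.
  by rewrite hornerZ hornerX mulrC.
(* Multiplying a relation 1 = p(1/u) with u = 1 - a by a power of u shows that
   this power lies in I, although it is congruent to 1 modulo I. *)
have A_invB a : I a -> A (1 - a)^-1.
  move=> Ia; apply: A_of_nexpr => n [c Ic]; set u := 1 - a => cE.
  have Iexp m : I (1 - u ^+ m).
    elim: m => [|m IHm]; first by rewrite expr0 subrr.
    rewrite (_ : 1 - u ^+ m.+1 = a + (1 - u ^+ m) - a * (1 - u ^+ m)).
      by apply: IB; [exact: ID | exact: IM].
    by rewrite /u exprS; ring.
  have u0 : u != 0.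
    by rewrite /u subr_eq0; apply: contra_not_neq I1 => ->.
  apply: I1; rewrite -[1](subrK (u ^+ n)); apply: ID => //.
  rewrite -[u ^+ n]mulr1 cE mulr_sumr; apply: Isum => i.
  rewrite [X in I X](_ : _ = c i - (1 - u ^+ (n - i)) * c i).
    by apply: IB => //; exact: IM.
  rewrite mulrBl mul1r opprB addrC subrK exprVn mulrCA mulrC.
  by rewrite -expfB_cond // ?(negPf u0) ?add0n // ltnW.
(* Both relations are shortened at once: that for x^-1, divided by the unit
   1 - d 0, rewrites the top power of x in terms of lower ones. *)
have shorten x n : x != 0 -> unit_expr I x n.+1 -> unit_expr I x^-1 n.+1 ->
    unit_expr I x n.
  move=> x0 [c Ic cE] [d Id dE].
  have Ad := A_invB _ (Id 0%N); set w := (1 - d 0%N)^-1 in Ad.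
  have d01 : 1 - d 0%N != 0.
    by rewrite subr_eq0; apply: contra_not_neq I1 => ->.
  have xnE : x ^+ n = \sum_(i < n) w * d (n - i)%N * x ^+ i.
    have : x ^+ n * (1 - d 0%N) = \sum_(i < n) d (n - i)%N * x ^+ i.
      rewrite {1}dE big_ord_recl expr0 mulr1 addrC addKr mulr_sumr.
      rewrite (reindex_inj rev_ord_inj) /=; apply: eq_bigr => i _.
      rewrite /bump /= add1n -subSn // subSS mulrCA; congr (_ * _).
      rewrite exprVn -expfB_cond ?(negPf x0) ?add0n ?leq_subr //.
      by rewrite subKn // ltnW.
    move=> /(canRL (mulfK d01)) ->; rewrite mulrC mulr_sumr.
    by apply: eq_bigr => i _; rewrite mulrA.
  exists (fun i => c i + c n * (w * d (n - i)%N)).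
    by move=> i; apply: ID => //; apply: IM => //; exact: Ad.
  rewrite cE big_ord_recr /= xnE mulr_sumr -big_split /=.
  by apply: eq_bigr => i _; rewrite mulrDl !mulrA.
have widen x n m : unit_expr I x n -> (n <= m)%N -> unit_expr I x m.
  move=> [c Ic cE] nm; exists (fun i => if (i < n)%N then c i else 0).
    by move=> i; case: ifP.
  rewrite cE (big_ord_widen m (fun i => c i * x ^+ i)) // big_mkcond /=.
  by apply: eq_bigr => i _; case: ifP => // _; rewrite mul0r.
have Atot x : A x \/ A x^-1.
  have [->|x0] := eqVneq x 0; first by left; apply: AI.
  have [[n xn]|nx] := EM (exists n, unit_expr I x n); last first.
    by left; apply: A_of_nexpr => n xn; apply: nx; exists n.
  have [[m xm]|nx'] := EM (exists n, unit_expr I x^-1 n); last first.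
    by right; apply: A_of_nexpr => m xm; apply: nx'; exists m.
  exfalso; have xV0 : x^-1 != 0 by rewrite invr_eq0.
  have {xm}: unit_expr I x^-1 (n + m) by apply: widen xm _; rewrite leq_addl.
  have {xn}: unit_expr I x (n + m) by apply: widen xn _; rewrite leq_addr.
  elim: (n + m)%N => [[c _]|l IHl xl xl'].
    by rewrite big_ord0 => /eqP; rewrite oner_eq0.
  by apply: IHl; apply: shorten => //; rewrite invrK.
have clA : subring_closed (fun x => `[< A x >]).
  split=> [|x y|x y]; rewrite !unfold_in /=.
  - exact/asboolP.
  - by move=> /asboolP Ax /asboolP Ay; exact/asboolP/AB.
  - by move=> /asboolP Ax /asboolP Ay; exact/asboolP/AM.
have totA x : (x \in (fun x => `[< A x >])) || (x^-1 \in (fun x => `[< A x >])).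
  by apply/orP; case: (Atot x) => ?; [left | right]; exact/asboolP.
exists (ValuationRing clA totA); split=> [a aA|x xI0].
  by apply/asboolP => i; exact: IA.
rewrite vmaxE; have [//|x0 /=] := eqVneq x 0; apply/negP => /asboolP AxV.
by apply: I1; rewrite -(mulVf x0); apply/AxV/I0I.
Qed.

End Chevalley.

(** A valuation ring [O] dominating the image of [V] meets [K] in [V]: if [x] is
    not in [V] then its inverse is in the maximal ideal of [O]. *)
Theorem valuation_ring_extension (K F : fieldType) (psi : {rmorphism K -> F})
    (V : valuation_ring K) :
  exists O : valuation_ring F, forall x, (psi x \in O) = (x \in V).
Proof.
pose img (S : {pred K}) : {pred F} :=
  fun y => `[< exists2 x, x \in S & y = psi x >].
have [||||O [AO IO]] := @chevalley F (img V) (img (vmax V)).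
- split=> [|_ _ /asboolP[x xm ->] /asboolP[y ym ->]]; apply/asboolP.
    by exists 0; rewrite ?rmorph0 ?rpred0.
  by exists (x - y); rewrite ?rmorphB ?rpredB.
- move=> _ _ /asboolP[x xm ->] /asboolP[y ym ->]; apply/asboolP.
  by exists (x * y); rewrite ?rmorphM // vmaxM // vmax_vring.
- move=> _ _ /asboolP[x xm ->] /asboolP[y ym ->]; apply/asboolP.
  by exists (x * y); rewrite ?rmorphM // vmaxM.
- apply/negP => /asboolP[x xm]; rewrite -(rmorph1 psi) => /fmorph_inj x1.
  by rewrite -x1 vmax1 in xm.
exists O => x; apply/idP/idP => [xO|xV]; last first.
  by apply: AO; apply/asboolP; exists x.
apply: contraLR xO => xV.
have x0 : x != 0 by apply: contraNneq xV => ->; rewrite rpred0.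
have : psi x^-1 \in vmax O.
  by apply: IO; apply/asboolP; exists x^-1; rewrite // vmaxE invrK xV orbT.
by rewrite vmaxE fmorph_eq0 invr_eq0 (negPf x0) fmorphV invrK.
Qed.

(** * Fields of finite rank over a subfield *)

Lemma fraction_quotient (R : idomainType) (f : {fraction R}) :
  exists x y : R, y != 0 /\ f = tofrac x / tofrac y.
Proof.
elim/quotW: f => f; exists \n_f, \d_f; split; first exact: denom_ratioP.
have d0 : tofrac \d_f != 0 :> {fraction R} by rewrite tofrac_eq0 denom_ratioP.
apply: (mulIf d0); rewrite divfK //.
apply/eqP; rewrite !piE /= FracField.equivfE /= /FracField.mulf.
rewrite !numden_Ratio ?mulf_neq0 ?oner_eq0 ?denom_ratioP //.
by rewrite !mulr1 mulrC.
Qed.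

(** [F] has dimension at most [N] over the image of [psi], in the form in which
    it is used. *)
Definition finite_rank (K F : fieldType) (psi : K -> F) (N : nat) : Prop :=
  forall f : 'I_N.+1 -> F, exists2 c : 'I_N.+1 -> K,
    exists i, c i != 0 & \sum_i psi (c i) * f i = 0.

Section FiniteRank.
Variables (K F : fieldType) (psi : {rmorphism K -> F}).

(** Multiplication by [x] maps the [K]-span of the family [S] to itself.  Such
    [x] form a ring containing [K], which is why it suffices to consider the
    generators of an algebra. *)
Definition stabilizes (T : finType) (S : T -> F) (x : F) : Prop :=
  exists t : T -> T -> K, forall i, x * S i = \sum_j psi (t i j) * S j.

Section Stabilizer.
Variables (T : finType) (S : T -> F).

Lemma stabilizes_scalar c : stabilizes S (psi c).
Proof.
exists (fun i j => c *+ (i == j)) => i.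
rewrite (bigD1 i) //= eqxx big1 ?addr0 //.
by move=> j; rewrite eq_sym => /negPf->; rewrite rmorph0 mul0r.
Qed.

Lemma stabilizesD x y :
  stabilizes S x -> stabilizes S y -> stabilizes S (x + y).
Proof.
move=> [t tE] [u uE]; exists (fun i j => t i j + u i j) => i.
rewrite mulrDl tE uE -big_split; apply: eq_bigr => j _.
by rewrite rmorphD mulrDl.
Qed.

Lemma stabilizesM x y :
  stabilizes S x -> stabilizes S y -> stabilizes S (x * y).
Proof.
move=> [t tE] [u uE]; exists (fun i j => \sum_l u i l * t l j) => i.
rewrite -mulrA uE mulr_sumr.
under eq_bigr => l _ do rewrite mulrCA tE mulr_sumr.
rewrite exchange_big; apply: eq_bigr => j _ /=.
by rewrite rmorph_sum mulr_suml; apply: eq_bigr => l _; rewrite rmorphM mulrA.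
Qed.

Lemma stabilizes_sum (I : Type) (s : seq I) (g : I -> F) :
  (forall i, stabilizes S (g i)) -> stabilizes S (\sum_(i <- s) g i).
Proof.
move=> gS; elim/big_ind: _ => //; last exact: stabilizesD.
by rewrite -(rmorph0 psi); exact: stabilizes_scalar.
Qed.

Lemma stabilizesX x n : stabilizes S x -> stabilizes S (x ^+ n).
Proof.
move=> xS; elim: n => [|n IHn]; last by rewrite exprS; exact: stabilizesM.
by rewrite expr0 -(rmorph1 psi); exact: stabilizes_scalar.
Qed.

Lemma stabilizes_prod (I : Type) (s : seq I) (g : I -> F) :
  (forall i, stabilizes S (g i)) -> stabilizes S (\prod_(i <- s) g i).
Proof.
move=> gS; elim/big_ind: _ => //; last exact: stabilizesM.
by rewrite -(rmorph1 psi); exact: stabilizes_scalar.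
Qed.

End Stabilizer.

(** The family is 1, a, ..., a^n, with n + 1 the degree of a monic relation. *)
Lemma algebraic_stabilizes a : algebraicOver psi a ->
  exists n (S : 'I_n.+1 -> F), S ord0 = 1 /\ stabilizes S a.
Proof.
move=> /integral_algebraic[p pmon /rootP pa].
have sp : (1 < size p)%N.
  rewrite ltnNge; apply/negP => /size1_polyC pC.
  move: pmon pa; rewrite pC monicE lead_coefC => /eqP ->.
  by rewrite map_polyC hornerC /= rmorph1 => /eqP; rewrite oner_eq0.
set n := (size p).-2.
have spE : size p = n.+2 by rewrite /n; case: size sp => [|[]].
have topE : a ^+ n.+1 = \sum_(j < n.+1) psi (- p`_j) * a ^+ j.
  move: pa; rewrite horner_coef size_map_poly spE big_ord_recr /= coef_map.
  have -> : p`_n.+1 = 1 by move/eqP: pmon; rewrite lead_coefE spE.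
  rewrite /= rmorph1 mul1r => /eqP; rewrite addrC addr_eq0 => /eqP ->.
  by rewrite -sumrN; apply: eq_bigr => j _; rewrite coef_map rmorphN mulNr.
exists n, (fun j : 'I_n.+1 => a ^+ j); split=> //.
exists (fun i j : 'I_n.+1 =>
  if i == n :> nat then - p`_j else (i.+1 == j :> nat)%:R) => i.
rewrite -exprS; case: eqP => [->//|/eqP ni].
have i1 : (i.+1 < n.+1)%N by rewrite ltnS ltn_neqAle ni -ltnS ltn_ord.
rewrite (bigD1 (Ordinal i1)) //= eqxx rmorph1 mul1r big1 ?addr0 // => j.
by rewrite -val_eqE /= eq_sym => /negPf->; rewrite rmorph0 mul0r.
Qed.

Lemma stabilizes_tensor (T1 T2 : finType) (S1 : T1 -> F) (S2 : T2 -> F) x :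
    stabilizes S1 x \/ stabilizes S2 x ->
  stabilizes (fun ij : T1 * T2 => S1 ij.1 * S2 ij.2) x.
Proof.
have one (S : T1 * T2 -> F) (g : T1 * T2 -> K) (h : T1 * T2 -> bool) :
    \sum_ij psi (g ij *+ h ij) * S ij = \sum_(ij | h ij) psi (g ij) * S ij.
  rewrite [RHS]big_mkcond; apply: eq_bigr => ij _.
  by case: (h ij); rewrite //= rmorph0 mul0r.
move=> [] [t tE].
  exists (fun ij kl => t ij.1 kl.1 *+ (kl.2 == ij.2)) => -[i j] /=.
  rewrite mulrA tE mulr_suml one.
  rewrite -(pair_big_dep xpredT (fun _ l => l == j)
    (fun k l => psi (t i k) * (S1 k * S2 l))) /=.
  by apply: eq_bigr => k _; rewrite big_pred1_eq mulrA.
exists (fun ij kl => t ij.2 kl.2 *+ (kl.1 == ij.1)) => -[i j] /=.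
rewrite mulrCA tE mulr_sumr one /=.
rewrite (eq_bigl (fun kl => (kl.1 == i) && true)); last first.
  by move=> kl; rewrite andbT.
rewrite -(pair_big_dep (fun k => k == i) (fun _ _ => true)
    (fun k l => psi (t j l) * (S1 k * S2 l))) /=.
by rewrite big_pred1_eq; apply: eq_bigr => k _; rewrite mulrCA.
Qed.

(** Since 1 is an entry of [S], the span of [S] contains every element that
    stabilizes it. *)
Lemma algebraic_family_stabilizes (s : seq F) :
    (forall a, a \in s -> algebraicOver psi a) ->
  exists (T : finType) (S : T -> F) (t0 : T),
    S t0 = 1 /\ forall a, a \in s -> stabilizes S a.
Proof.
elim: s => [_|a s IHs sP].
  by exists unit, (fun _ => 1), tt.
have [b bs|T2 [S2 [t2 [S2t2 S2P]]]] := IHs.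
  by apply: sP; rewrite inE bs orbT.
have [n [S1 [S10 S1a]]] := algebraic_stabilizes (sP a (mem_head _ _)).
exists ('I_n.+1 * T2)%type, (fun ij => S1 ij.1 * S2 ij.2), (ord0, t2).
split=> [/=|b]; first by rewrite S10 S2t2 mulr1.
rewrite inE => /predU1P[->|/S2P bS]; apply: stabilizes_tensor; first by left.
by right.
Qed.

End FiniteRank.

(** Elements of the fraction field are brought into [R], hence into the span of
    [S], by a common denominator. *)
Lemma finite_rank_fraction (K : fieldType) (R : idomainType)
    (psi : {rmorphism K -> {fraction R}})
    (T : finType) (S : T -> {fraction R}) (t0 : T) : S t0 = 1 ->
    (forall x : R, stabilizes psi S (tofrac x)) ->
  finite_rank psi #|T|.
Proof.
move=> S1 RS f.
have fP i : exists x : R * R, x.2 != 0 /\ f i = tofrac x.1 / tofrac x.2.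
  by have [x [y [y0 ->]]] := fraction_quotient (f i); exists (x, y).
pose num i := (projT1 (cid (fP i))).1; pose den i := (projT1 (cid (fP i))).2.
have den0 i : den i != 0 by case: (projT2 (cid (fP i))).
have fE i : f i = tofrac (num i) / tofrac (den i).
  by case: (projT2 (cid (fP i))).
pose q := \prod_i den i.
have q0 : tofrac q != 0.
  by rewrite tofrac_eq0; apply/prodf_neq0 => i _; exact: den0.
have qf i : exists x : R, tofrac q * f i = tofrac x.
  exists (num i * \prod_(j | j != i) den j).
  rewrite /q (bigD1 i) //= fE !rmorphM /= [_ / _]mulrC mulrACA.
  by rewrite divff ?tofrac_eq0 // mul1r mulrC.
have span i : exists t : T -> K, tofrac q * f i = \sum_j psi (t j) * S j.
  have [x ->] := qf i; have [t /(_ t0)] := RS x.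
  by rewrite S1 mulr1; exists (t t0).
pose C : 'M[K]_(#|T|.+1, #|T|) :=
  \matrix_(i, j) projT1 (cid (span i)) (enum_val j).
have CE i : tofrac q * f i = \sum_j psi (C i j) * S (enum_val j).
  rewrite (projT2 (cid (span i))) (reindex (@enum_val T T)).
    by apply: eq_bigr => j _; rewrite mxE.
  exact/onW_bij/enum_val_bij.
have kerC : kermx C != 0.
  by rewrite kermx_eq0 /row_free neq_ltn ltnS rank_leq_col.
have [u /sub_kermxP uC u0] := rowV0Pn kerC.
have /rV0Pn[i ui] := u0.
exists (fun i => u 0 i); first by exists i.
apply: (mulfI q0); rewrite mulr0 mulr_sumr.
under eq_bigr => l _ do rewrite mulrCA CE mulr_sumr.
rewrite exchange_big big1 // => j _ /=.
have uCj : \sum_l u 0 l * C l j = 0.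
  by move/matrixP/(_ 0 j): uC; rewrite mxE [RHS]mxE.
rewrite -[RHS](mul0r (S (enum_val j))) -[X in X * _](rmorph0 psi) -uCj.
rewrite rmorph_sum mulr_suml; apply: eq_bigr => l _.
by rewrite rmorphM mulrA.
Qed.

(** * Subgroups of finite index of a lattice *)

(** By Cramer's rule these determinants are, up to division by [\det M], the
    coordinates of [v] on the rows of [M]. *)
Lemma det_set_row r (M : 'M[int]_r) (i : 'I_r) (v : 'rV[int]_r) :
  \det (\matrix_(k, j) if k == i then v 0 j else M k j) = (v *m \adj M) 0 i.
Proof.
rewrite (expand_det_row _ i) mxE; apply: eq_bigr => j _.
rewrite !mxE eqxx /cofactor; congr (_ * (_ * \det _)).
by apply/matrixP => k l; rewrite !mxE eq_sym (negPf (neq_lift _ _)).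
Qed.

(** Rows in [G] whose determinant has the least nonzero absolute value form a
    basis: for a vector of [G] outside of their span, some coordinate is not an
    integer, and replacing a row by the vector minus a multiple of that row
    multiplies the determinant by the fractional part of the coordinate. *)
Lemma lattice_basis r (G : 'rV[int]_r -> Prop) (e : int) :
    e != 0 -> (forall x y, G x -> G y -> G (x - y)) -> (forall x, G (e *: x)) ->
  exists2 M : 'M[int]_r, \det M != 0 &
    (forall y, G (y *m M)) /\ (forall g, G g -> exists y, g = y *m M).
Proof.
move=> e0 GB Ge.
have G0 : G 0 by rewrite -(scaler0 _ e).
have GN x : G x -> G (- x) by rewrite -sub0r; exact: GB.
have GD x y : G x -> G y -> G (x + y).
  by move=> Gx Gy; rewrite -[y]opprK; apply/GB/GN.
have GMn x n : G x -> G (x *+ n).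
  by move=> Gx; elim: n => [|n IHn]; rewrite ?mulr0n // mulrS; exact: GD.
have GZ (c : int) x : G x -> G (c *: x).
  move=> Gx; rewrite -[c]intz scaler_int; case: c => n; first exact: GMn.
  by rewrite NegzE mulrNz; apply/GN/GMn.
pose P n := `[< exists M : 'M[int]_r,
  [/\ forall i, G (row i M), \det M != 0 & `|\det M|%N = n] >].
have exP : exists n, P n.
  exists `|\det (e%:M : 'M[int]_r)|%N; apply/asboolP.
  exists e%:M; split=> // [i|].
    by rewrite -scalemx1 linearZ; exact: Ge.
  by rewrite det_scalar expf_neq0.
case: (ex_minnP exP) => n /asboolP[M [MG M0 Mn]] minM.
exists M => //; split=> [y|g Gg].
  rewrite mulmx_sum_row; elim/big_ind: _ => // i _; exact: GZ.
pose d := \det M.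
have div_d i : ((g *m \adj M) 0%R i %% d)%Z = 0.
  set a := (g *m \adj M) 0 i; apply/eqP/negPn/negP => rem0.
  pose v := g - (a %/ d)%Z *: row i M.
  pose M' := \matrix_(k, j) if k == i then v 0 j else M k j.
  have detM' : \det M' = (a %% d)%Z.
    have rowd : row i (\det M)%:M 0 i = d by rewrite !mxE eqxx.
    rewrite det_set_row mulmxBl -scalemxAl -row_mul mul_mx_adj mxE -/a.
    by rewrite [X in a + X]mxE [X in a - X]mxE rowd.
  have : P `|\det M'|%N.
    apply/asboolP; exists M'; split=> // [k|]; last by rewrite detM'.
    have [->|ki] := eqVneq k i.
      rewrite (_ : row i M' = v); last by apply/rowP => j; rewrite !mxE eqxx.
      by apply: GB => //; exact: GZ.
    rewrite (_ : row k M' = row k M) //.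
    by apply/rowP => j; rewrite !mxE (negPf ki).
  move/minM; rewrite -Mn detM' leqNgt -ltz_nat => /negP; apply.
  by rewrite gez0_abs ?modz_ge0 ?ltz_mod.
exists (\row_i ((g *m \adj M) 0%R i %/ d)%Z).
suff dE : d *: g = d *: (\row_i ((g *m \adj M) 0%R i %/ d)%Z *m M).
  apply/rowP => j; apply: (mulfI M0).
  by move/rowP/(_ j): dE; rewrite mxE [RHS]mxE.
rewrite scalemxAl -mul_mx_scalar -(mul_adj_mx M) mulmxA; congr (_ *m M).
apply/rowP => i; rewrite [RHS]mxE [X in d * X]mxE [LHS](divz_eq _ d) div_d.
by rewrite addr0 mulrC.
Qed.

(** * The monomial valuation of a field of rational functions *)

Section MonomialValuation.
Variables (k : fieldType) (r : nat).
Local Notation P := {mpoly k[r]}.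
Local Notation K := {fraction P}.
Implicit Types (p q : P) (x y : K).

(** The value of a quotient is the leading monomial of its denominator minus
    that of its numerator.  The numerator 0 is covered since its leading
    monomial is, by convention, the least one. *)
Let V : {pred K} := fun x =>
  `[< exists p q,
    [/\ q != 0, x = tofrac p / tofrac q & (mlead p <= mlead q)%O] >].

Let VE p q : q != 0 -> (tofrac p / tofrac q \in V) = (mlead p <= mlead q)%O.
Proof.
move=> q0; apply/asboolP/idP => [[p' [q' [q'0 E le]]]|]; last by exists p, q.
have [->|p0] := eqVneq p 0; first by rewrite mlead0 le0m.
have {}E : p * q' = p' * q.
  apply/eqP; rewrite -tofrac_eq !rmorphM /=.
  move/eqP: E; rewrite eqr_div ?tofrac_eq0 // => /eqP ->.
have p'0 : p' != 0.
  by apply: contraNneq (mulf_neq0 p0 q'0) => p'0; rewrite E p'0 mul0r.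
move/(congr1 (@mlead _ _)): E; rewrite !mleadM // => E.
by rewrite -(lemc_add2l _ _ (mlead q')) E [(mlead q + _)%MM]addmC lemc_add2l.
Qed.

Let V_closed : subring_closed V.
Proof.
split=> [|x y|x y].
- by rewrite -[1](divr1 1) -tofrac1 VE ?oner_eq0.
- have [p [q [q0 ->]]] := fraction_quotient x.
  have [p' [q' [q'0 ->]]] := fraction_quotient y.
  rewrite !VE // => pq pq'; rewrite -mulNr addf_div ?tofrac_eq0 //.
  rewrite mulNr -!rmorphM -rmorphB VE ?mulf_neq0 //.
  apply: le_trans (mleadB_le _ _) _.
  rewrite leUx !(le_trans (mleadM_le _ _)) //.
    by rewrite mleadM // [(mlead q + _)%MM]addmC lemc_add2l.
  by rewrite mleadM // lemc_add2l.
- have [p [q [q0 ->]]] := fraction_quotient x.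
  have [p' [q' [q'0 ->]]] := fraction_quotient y.
  rewrite !VE // => pq pq'; rewrite mulf_div -!rmorphM VE ?mulf_neq0 //.
  by apply: le_trans (mleadM_le _ _) _; rewrite mleadM // lem_add.
Qed.

Let V_total x : (x \in V) || (x^-1 \in V).
Proof.
have [p [q [q0 ->]]] := fraction_quotient x; rewrite invf_div VE //.
have [->|p0] := eqVneq p 0; first by rewrite mlead0 le0m.
by rewrite VE // le_total.
Qed.

Let mvec (m : 'X_{1..r}) : 'rV[int]_r := \row_i (m i)%:Z.

Let mvecD m n : mvec (m + n)%MM = mvec m + mvec n.
Proof. by apply/rowP => i; rewrite !mxE mnmDE PoszD. Qed.

Let mvec_inj : injective mvec.
Proof.
by move=> m n /rowP mn; apply/mnmP => i; have := mn i; rewrite !mxE => -[].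
Qed.

(** The value map [v] is taken with the opposite sign to that of the ring [W]:
    only its kernel and its being onto matter, and the order on values is read
    off from [W].  The residue of a quotient in [W] is the quotient of the
    coefficients at the leading monomial of the denominator. *)
Theorem monomial_valuation :
    exists (W : valuation_ring K) (v : K -> 'rV[int]_r),
  [/\ forall x y, x != 0 -> y != 0 -> v (x * y) = v x + v y,
      forall x, x != 0 -> (v x == 0) = (x \in vunit W),
      forall n, exists2 x, x != 0 & v x = n,
      forall a : k, tofrac a%:MP \in W
    & forall x, x \in W -> exists a : k, x - tofrac a%:MP \in vmax W].
Proof.
pose repr_of x := cid (fraction_quotient x).
pose num x := projT1 (repr_of x).
pose den x := projT1 (cid (projT2 (repr_of x))).
have den0 x : den x != 0 by case: (projT2 (cid (projT2 (repr_of x)))).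
have xE x : x = tofrac (num x) / tofrac (den x).
  by case: (projT2 (cid (projT2 (repr_of x)))).
pose v x := mvec (mlead (num x)) - mvec (mlead (den x)).
have vE p q : p != 0 -> q != 0 ->
    v (tofrac p / tofrac q) = mvec (mlead p) - mvec (mlead q).
  move=> p0 q0; rewrite /v; set x := _ / _; have := xE x.
  have num0 : num x != 0.
    apply: contra_neq p0 => n0; apply/eqP; rewrite -tofrac_eq0.
    have := xE x; rewrite n0 rmorph0 mul0r => /eqP.
    by rewrite mulf_eq0 invr_eq0 !tofrac_eq0 (negPf q0) orbF.
  rewrite [in LHS]/x => /eqP.
  rewrite eqr_div ?tofrac_eq0 // -!rmorphM tofrac_eq.
  move=> /eqP/(congr1 (@mlead _ _)); rewrite !mleadM // => /(congr1 mvec).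
  rewrite !mvecD => E; apply/eqP; by rewrite subr_eq addrAC eq_sym subr_eq E.
exists (ValuationRing V_closed V_total), v.
have quot0 p q : q != 0 -> (tofrac p / tofrac q == 0 :> K) = (p == 0).
  by move=> q0; rewrite mulf_eq0 invr_eq0 !tofrac_eq0 (negPf q0) orbF.
split=> [x y|x|n|a|x].
- have [p [q [q0 ->]]] := fraction_quotient x.
  have [p' [q' [q'0 ->]]] := fraction_quotient y.
  rewrite !quot0 // => p0 p'0; rewrite mulf_div -!rmorphM !vE ?mulf_neq0 //.
  by rewrite !mleadM // !mvecD opprD addrACA.
- have [p [q [q0 ->]]] := fraction_quotient x; rewrite quot0 // => p0.
  rewrite vE // vunitE invf_div [_ \in _]VE // [in RHS]VE // -eq_le subr_eq0.
  exact: inj_eq mvec_inj _ _.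
- pose m : 'X_{1..r} := [multinom `|Num.max (n 0%R i) 0%R|%N | i < r].
  pose m' : 'X_{1..r} := [multinom `|Num.max (- n 0%R i)%R 0%R|%N | i < r].
  have X0 l : 'X_[l] != 0 :> P.
    by rewrite -mleadc_eq0 mleadXm mcoeffX eqxx oner_eq0.
  exists (tofrac 'X_[m] / tofrac 'X_[m']); first by rewrite quot0.
  rewrite vE // !mleadXm; apply/rowP => i; rewrite !mxE !mnmE; lia.
- by rewrite -[tofrac _]divr1 -tofrac1 [_ \in _]VE ?oner_eq0 // mleadC le0m.
- have [p [q [q0 ->]]] := fraction_quotient x; rewrite [_ \in _]VE // => le_pq.
  pose a := p@_(mlead q) / q@_(mlead q); exists a.
  have qq0 : tofrac q != 0 by rewrite tofrac_eq0.
  have -> : tofrac p / tofrac q - tofrac a%:MP = tofrac (p - a *: q) / tofrac q.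
    move: a => a; rewrite rmorphB mulrBl /= -mul_mpolyC rmorphM /=.
    by rewrite mulfK.
  have [->|d0] := eqVneq (p - a *: q) 0; first by rewrite rmorph0 mul0r rpred0.
  rewrite vmaxE quot0 // (negPf d0) invf_div [_ \in _]VE //= -ltNge lt_neqAle.
  apply/andP; split; last first.
    by apply: le_trans (mleadB_le _ _) _; rewrite leUx le_pq mleadZ_le.
  apply: contraTneq (mlead_supp d0) => ->.
  by rewrite mcoeff_msupp negbK mcoeffB mcoeffZ divfK ?subrr ?mleadc_eq0.
Qed.

End MonomialValuation.

(** * Extension of the value map *)

(** The value group of [F] is torsion over that of [K]: the powers of [f] up to
    the [N]-th are dependent over [K], so that two terms c f^i and c' f^j of a
    relation have the same value, and the exponent [N!] is a multiple of every
    possible difference j - i. *)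
Lemma value_torsion (K F : fieldType) (psi : {rmorphism K -> F}) (N : nat)
    (O : valuation_ring F) : finite_rank psi N ->
  forall f : F, f != 0 ->
  exists2 c : K, c != 0 & f ^+ N`! / psi c \in vunit O.
Proof.
move=> rkN f f0; have [c [i0 ci0] c0] := rkN (fun i => f ^+ i).
have fX0 i : f ^+ i != 0 by rewrite expf_neq0.
have [|i [j [+ gi gj gij gji]]] := sum0_equal_values O (i0 := i0) _ c0.
  by rewrite mulf_neq0 ?fmorph_eq0.
wlog lt_ij : i j gi gj gij gji / (i < j)%N => [hw|_].
  have [ij|ji|/val_inj ->] := ltngtP i j; last by rewrite eqxx.
    exact: (hw i j).
  by rewrite eq_sym; exact: (hw j i).
move: gi gj; rewrite !mulf_eq0 !fmorph_eq0 !negb_or => /andP[ci _] /andP[cj _].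
set d := (j - i)%N.
have fd : f ^+ d / psi (c i / c j) \in vunit O.
  rewrite vunitE (_ : f ^+ d / _ = psi (c j) * f ^+ j / (psi (c i) * f ^+ i)).
    by rewrite gji /= invf_div.
  rewrite -(subnK (ltnW lt_ij)) exprD -/d fmorph_div.
  by field; rewrite !fmorph_eq0 ci cj fX0.
have d_gt0 : (0 < d)%N by rewrite subn_gt0.
have dvd_d : (d %| N`!)%N.
  rewrite dvdn_fact // d_gt0 /d (leq_trans (leq_subr _ _)) //.
  by rewrite -ltnS ltn_ord.
exists ((c i / c j) ^+ (N`! %/ d)).
  by rewrite expf_neq0 // mulf_neq0 ?invr_eq0.
rewrite -{1}(divnK dvd_d) mulnC exprM rmorphXn -expr_div_n.
exact: vunitX.
Qed.

(** A torsion-free group that is torsion of bounded exponent over [Z^r] is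
    isomorphic to [Z^r]; the coordinates with respect to a basis of the value
    group of [F] are the new value map. *)
Theorem value_map_extension (K F : fieldType) (psi : {rmorphism K -> F})
    (N r : nat) (W : valuation_ring K) (v : K -> 'rV[int]_r) :
    finite_rank psi N ->
    (forall x y, x != 0 -> y != 0 -> v (x * y) = v x + v y) ->
    (forall x, x != 0 -> (v x == 0) = (x \in vunit W)) ->
    (forall n, exists2 x, x != 0 & v x = n) ->
  exists (O : valuation_ring F) (nu : F -> 'rV[int]_r),
  [/\ forall x, (psi x \in O) = (x \in W),
      forall x y, x != 0 -> y != 0 -> nu (x * y) = nu x + nu y,
      forall x, x != 0 -> (nu x == 0) = (x \in vunit O)
    & forall n, exists2 x, x != 0 & nu x = n].
Proof.
move=> rkN vM v0 vsurj.
have [O OW] := valuation_ring_extension psi W.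
have uOW x : (psi x \in vunit O) = (x \in vunit W).
  by rewrite !vunitE -fmorphV !OW.
set e := N`!; have e_gt0 : (0 < e)%N by exact: fact_gt0.
have vV x : x != 0 -> v x^-1 = - v x.
  move=> x0; apply/eqP.
  rewrite -addr_eq0 -vM ?invr_eq0 // mulVf // v0 ?oner_eq0 //.
  exact: vunit1.
have vX x n : x != 0 -> v (x ^+ n) = v x *+ n.
  move=> x0; elim: n => [|n IHn].
    by apply/eqP; rewrite expr0 mulr0n v0 ?oner_eq0 // vunit1.
  by rewrite exprS vM ?expf_neq0 // IHn mulrS.
(* The map w is N! times the extension of v, so that it takes values in Z^r; it
   identifies the value group of O with a subgroup of Z^r. *)
have /choice[w wP] : forall f : F, exists y : 'rV[int]_r, f != 0 ->
    exists c, [/\ c != 0, f ^+ e / psi c \in vunit O & y = v c].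
  move=> f.
  have [->|f0] := eqVneq f 0; first by exists 0.
  by have [c c0 fc] := value_torsion O rkN f0; exists (v c) => _; exists c.
have w_eq f c : f != 0 -> c != 0 -> f ^+ e / psi c \in vunit O -> w f = v c.
  move=> f0 c0 fc; have [c' [c'0 fc' ->]] := wP f f0.
  apply/eqP; rewrite -subr_eq0 -vV // -vM ?invr_eq0 // v0; last first.
    by rewrite mulf_neq0 ?invr_eq0.
  rewrite -uOW (_ : psi _ = (f ^+ e / psi c) / (f ^+ e / psi c')).
    by apply: vunitM => //; rewrite vunitV.
  by rewrite fmorph_div; field; rewrite !fmorph_eq0 c0 c'0 expf_neq0.
have wM f g : f != 0 -> g != 0 -> w (f * g) = w f + w g.
  move=> f0 g0; have [c [c0 fc ->]] := wP f f0; have [d [d0 gd ->]] := wP g g0.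
  rewrite -vM //; apply: w_eq; rewrite ?mulf_neq0 //.
  by rewrite exprMn rmorphM -mulf_div vunitM.
have w0 f : f != 0 -> (w f == 0) = (f \in vunit O).
  move=> f0; have [c [c0 fc ->]] := wP f f0; rewrite v0 // -uOW.
  apply/idP/idP => [cu|fu].
    apply: (vunit_expV e_gt0); have psic0 : psi c != 0 by rewrite fmorph_eq0.
    by rewrite -(divfK psic0 (f ^+ e)); exact: vunitM fc cu.
  rewrite -vunitV (_ : (psi c)^-1 = (f ^+ e / psi c) / f ^+ e).
    by rewrite vunitM // vunitV vunitX.
  by rewrite mulrAC divff ?mul1r // expf_neq0.
have wV f : f != 0 -> w f^-1 = - w f.
  move=> f0; apply/eqP.
  rewrite -addr_eq0 -wM ?invr_eq0 // mulVf // w0 ?oner_eq0 //.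
  exact: vunit1.
have [|||M M0 [MG GM]] := @lattice_basis r
    (fun y => exists2 f, f != 0 & w f = y) e%:Z.
- by rewrite -lt0n.
- move=> _ _ [f f0 <-] [g g0 <-]; exists (f / g).
    by rewrite mulf_neq0 ?invr_eq0.
  by rewrite wM ?invr_eq0 // wV.
- move=> x; have [c c0 <-] := vsurj x.
  exists (psi c); first by rewrite fmorph_eq0.
  rewrite (w_eq _ (c ^+ e)) ?expf_neq0 ?fmorph_eq0 //.
    by rewrite vX // -scaler_nat natz.
  by rewrite rmorphXn divff ?vunit1 // expf_neq0 // fmorph_eq0.
have M_inj (y y' : 'rV[int]_r) : y *m M = y' *m M -> y = y'.
  move=> yM; have yy' : \det M *: y = \det M *: y'.
    by rewrite -!mul_mx_scalar -mul_mx_adj !mulmxA yM.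
  apply/rowP => i; apply: (mulfI M0).
  by move/rowP/(_ i): yy'; rewrite mxE [RHS]mxE.
have /choice[nu nuP] : forall f : F, exists y : 'rV[int]_r, f != 0 ->
    w f = y *m M.
  move=> f.
  have [->|f0] := eqVneq f 0; first by exists 0.
  by have [|y wy] := GM (w f); [exists f | exists y].
exists O, nu; split=> // [f g f0 g0|f f0|n].
- by apply: M_inj; rewrite mulmxDl -!nuP ?mulf_neq0 // wM.
- rewrite -w0 // nuP //; apply/eqP/eqP => [->|]; first by rewrite mul0mx.
  by move=> nuM; apply: M_inj; rewrite nuM mul0mx.
- by have [f f0 wf] := MG n; exists f => //; apply: M_inj; rewrite -nuP.
Qed.

(** * Transcendence bases *)

Lemma fraction_lift (A : idomainType) (F : fieldType)
    (phi : {rmorphism A -> F}) :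
    injective phi ->
  exists psi : {rmorphism {fraction A} -> F}, forall x, psi (tofrac x) = phi x.
Proof.
move=> phi_inj; have phi0 x : (phi x == 0) = (x == 0).
  by rewrite -(inj_eq phi_inj) rmorph0.
have fP (f : {fraction A}) : exists y, forall a b, b != 0 ->
    f = tofrac a / tofrac b -> y = phi a / phi b.
  have [a [b [b0 ->]]] := fraction_quotient f; exists (phi a / phi b) => c d d0.
  move=> /eqP; rewrite eqr_div ?tofrac_eq0 // -!rmorphM tofrac_eq => /eqP E.
  by apply/eqP; rewrite eqr_div ?phi0 // -!rmorphM E.
have {fP}/choice[psi psiP] := fP.
have psiE a b : b != 0 -> psi (tofrac a / tofrac b) = phi a / phi b.
  by move=> b0; exact: psiP.
have psiB : zmod_morphism psi.
  move=> f g; have [a [b [b0 ->]]] := fraction_quotient f.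
  have [c [d [d0 ->]]] := fraction_quotient g.
  rewrite !psiE // -!mulNr !addf_div ?tofrac_eq0 ?phi0 //.
  by rewrite !mulNr -!rmorphM -!rmorphB psiE ?mulf_neq0.
have psiM : monoid_morphism psi.
  split=> [|f g].
    by rewrite -[1](divr1 1) -tofrac1 psiE ?oner_eq0 // rmorph1 divr1.
  have [a [b [b0 ->]]] := fraction_quotient f.
  have [c [d [d0 ->]]] := fraction_quotient g.
  by rewrite !psiE // !mulf_div -!rmorphM psiE ?mulf_neq0.
pose psiB' := GRing.isZmodMorphism.Build _ _ psi psiB.
pose psiM' := GRing.isMonoidMorphism.Build _ _ psi psiM.
pose psi' : {rmorphism {fraction A} -> F} := HB.pack psi psiB' psiM'.
exists psi' => x; rewrite -[tofrac x]divr1 -tofrac1 /= psiE ?oner_eq0 //.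
by rewrite rmorph1 divr1.
Qed.

Section TranscendenceBasis.
Variables (k : fieldType) (A : comAlgType k) (r : nat) (z : 'I_r -> A) (a : A).

Let za (i : 'I_r.+1) : A := if unlift ord_max i is Some j then z j else a.

Let trunc (m : 'X_{1..r.+1}) : 'X_{1..r} :=
  [multinom (m (widen_ord (leqnSn r) i)) | i < r].

Let trunc_inj m m' : trunc m = trunc m' -> m ord_max = m' ord_max -> m = m'.
Proof.
move=> /mnmP tmm' mm'; apply/mnmP => i.
have [j ->|->//] := unliftP ord_max i.
have := tmm' j; rewrite !mnmE (_ : lift ord_max j = widen_ord (leqnSn r) j) //.
by apply: val_inj; rewrite /= /bump leqNgt ltn_ord.
Qed.

Let muni_eq0 (p : {mpoly k[r.+1]}) : muni p = 0 -> p = 0.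
Proof.
move=> p0; apply/eqP; rewrite -[p == 0]negbK; apply/negP => /mlead_supp.
set m := mlead p => mp; have := congr1 (fun q : {poly {mpoly k[r]}} =>
  mcoeff (trunc m) q`_(m ord_max)) p0.
rewrite muniE coef_sum raddf_sum /= coef0 mcoeff0 (bigD1_seq m) ?msupp_uniq //=.
rewrite big1_seq => [|m' /andP[m'm _]].
  rewrite addr0 coefZ coefXn eqxx mulr1 mcoeffZ mcoeffX eqxx mulr1 => /eqP.
  by apply/negP; rewrite -mcoeff_msupp.
rewrite coefZ coefXn; case: eqP => [e|_]; last by rewrite mulr0 mcoeff0.
rewrite mulr1 mcoeffZ mcoeffX; case: eqP => [e'|_]; last by rewrite mulr0.
by case/eqP: m'm; apply: trunc_inj.
Qed.

Let horner_muni (phi : {rmorphism {mpoly k[r]} -> A}) (p : {mpoly k[r.+1]}) :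
    (forall q, phi q = mmap (in_alg A) z q) ->
  (map_poly phi (muni p)).[a] = mmap (in_alg A) za p.
Proof.
move=> phiE; rewrite muniE rmorph_sum horner_sum /mmap; apply: eq_bigr => m _.
rewrite /= map_polyZ map_polyXn hornerZ hornerXn phiE mmapZ mmapX -mulrA.
congr (_ * _); rewrite /mmap1 big_ord_recr /= /za unlift_none; congr (_ * _).
apply: eq_bigr => i _; rewrite mnmE.
rewrite (_ : widen_ord _ _ = lift ord_max i) ?liftK //.
by apply: val_inj; rewrite /= /bump leqNgt ltn_ord.
Qed.

(** A polynomial vanishing at [z] followed by [a] is read as a polynomial in its
    last variable. *)
Lemma algebraic_relation : (forall y : 'I_r.+1 -> A, ~ alg_indep y) ->
  exists2 q : {poly {mpoly k[r]}}, q != 0 &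
    (map_poly (mmap (in_alg A) z) q).[a] = 0.
Proof.
move=> /(_ za) /existsNP[p /not_implyP[pa /eqP p0]].
exists (muni p); first by apply: contra_neq p0; exact: muni_eq0.
by rewrite -[RHS]pa -(horner_muni (phi := mmap (in_alg A) z)).
Qed.

End TranscendenceBasis.

Lemma transcendence_basis_algebraic
    (k : fieldType) (R : domainAlgType k) (r : nat)
    (z : 'I_r -> {fraction R})
    (psi : {rmorphism {fraction {mpoly k[r]}} -> {fraction R}}) :
    (forall p, psi (tofrac p) = mmap (in_alg {fraction R}) z p) ->
    (forall y : 'I_r.+1 -> {fraction R}, ~ alg_indep y) ->
  forall a, algebraicOver psi a.
Proof.
move=> psiE z_max a; have [q q0 qa] := algebraic_relation z a z_max.
exists (map_poly (@tofrac _) q).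
  by rewrite map_poly_eq0_id0 // tofrac_eq0 lead_coef_eq0.
rewrite /root -map_poly_comp; apply/eqP; rewrite -[RHS]qa; congr (_.[a]).
by apply: eq_map_poly => p /=; rewrite psiE.
Qed.

Lemma finitely_generated_finite_rank
    (k : fieldType) (R : domainAlgType k) (r : nat)
    (z : 'I_r -> {fraction R})
    (psi : {rmorphism {fraction {mpoly k[r]}} -> {fraction R}}) :
    finitely_generated R ->
    (forall p, psi (tofrac p) = mmap (in_alg {fraction R}) z p) ->
    (forall a, algebraicOver psi a) ->
  exists N, finite_rank psi N.
Proof.
move=> [m [a aP]] psiE alg.
have [b _|T [S [t0 [St0 SP]]]] := @algebraic_family_stabilizes _ _ psi
  [seq tofrac (a i) | i <- enum 'I_m]; first exact: alg.
exists #|T|; apply: (finite_rank_fraction St0) => x.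
have [p ->] := aP x; rewrite /mmap rmorph_sum; apply: stabilizes_sum => l.
rewrite rmorphM; apply: stabilizesM.
  have := stabilizes_scalar psi S (tofrac (p@_l)%:MP).
  by rewrite psiE mmapC /= [_%:A]mulr1.
rewrite rmorph_prod; apply: stabilizes_prod => i.
rewrite rmorphXn; apply: stabilizesX; apply: SP.
by apply/map_f; rewrite mem_enum.
Qed.

(** * From valuation rings to valuations *)

(** Values are compared by dividing elements that have them. *)
Lemma valuation_of_ring (F : fieldType) (O : valuation_ring F) (r : nat)
    (nu : F -> 'rV[int]_r) :
    (forall x y, x != 0 -> y != 0 -> nu (x * y) = nu x + nu y) ->
    (forall x, x != 0 -> (nu x == 0) = (x \in vunit O)) ->
    (forall n, exists2 x, x != 0 & nu x = n) ->
  exists (o : group_order r) (mu : valuation F o), mu =1 nu /\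
    forall x y, x != 0 -> y != 0 -> o (nu x) (nu y) = (y / x \in O).
Proof.
move=> nuM nu0 nu_surj.
have nu_eq x y : x != 0 -> y != 0 -> nu x = nu y -> x / y \in vunit O.
  move=> x0 y0 xy; rewrite -nu0 ?mulf_neq0 ?invr_eq0 //; apply/eqP.
  apply: (addIr (nu y)).
  by rewrite -nuM ?mulf_neq0 ?invr_eq0 // divfK // add0r.
have /choice[s sP] : forall n, exists x, x != 0 /\ nu x = n.
  by move=> n; have [x x0 xn] := nu_surj n; exists x.
have s0 n : s n != 0 by case: (sP n).
have nus n : nu (s n) = n by case: (sP n).
pose le n m := s m / s n \in O.
have leE x y : x != 0 -> y != 0 -> le (nu x) (nu y) = (y / x \in O).
  move=> x0 y0; rewrite /le.
  have /andP[ux uxV] : s (nu x) / x \in vunit O by apply: nu_eq.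
  have /andP[uy uyV] : s (nu y) / y \in vunit O by apply: nu_eq.
  apply/idP/idP => [sO|xyO].
    rewrite (_ : y / x =
      (s (nu y) / y)^-1 * (s (nu y) / s (nu x)) * (s (nu x) / x)).
      by rewrite rpredM // rpredM.
    by field; rewrite x0 y0 !s0.
  rewrite (_ : _ / _ = (s (nu y) / y) * (y / x) * (s (nu x) / x)^-1).
    by rewrite rpredM // rpredM.
  by field; rewrite x0 y0 !s0.
have le_refl : reflexive le by move=> n; rewrite /le divff ?rpred1.
have le_anti : antisymmetric le.
  move=> n m /andP[nm mn].
  have : s m / s n \in vunit O by rewrite vunitE invf_div; apply/andP.
  rewrite -nu0 ?mulf_neq0 ?invr_eq0 // => /eqP nu_q0.
  rewrite -(nus m) -(divfK (s0 n) (s m)) nuM ?mulf_neq0 ?invr_eq0 //.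
  by rewrite nu_q0 add0r.
have le_trans : transitive le.
  move=> m n p nm mp; rewrite /le (_ : s p / s n = (s p / s m) * (s m / s n)).
    exact: rpredM.
  by rewrite mulrA divfK.
have le_total : total le.
  by move=> n m; rewrite /le -[s n / s m]invf_div vring_total.
have lt_add n m p :
    (n != m) && le n m -> (n + p != m + p) && le (n + p) (m + p).
  rewrite (inj_eq (addIr p)) => /andP[-> nm] /=.
  rewrite -[n]nus -[m]nus -[p]nus -!nuM // leE ?mulf_neq0 //.
  by rewrite invfM mulrACA divff // mulr1.
pose o := GroupOrder le_refl le_anti le_trans le_total lt_add.
have nuD f g : f != 0 -> g != 0 -> f + g != 0 ->
    o (omin o (nu f) (nu g)) (nu (f + g)).
  move=> f0 g0 fg0; rewrite /omin /=; case: ifP => [|/negbT nfg].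
    rewrite !leE // => fg; rewrite mulrDl divff //.
    by rewrite rpredD // rpred1.
  have := le_total (nu f) (nu g); rewrite (negPf nfg) /= !leE // => gf.
  by rewrite mulrDl divff // rpredD // rpred1.
by exists o, (Valuation nuM nuD).
Qed.

(** * Dimension of the leaves *)

Local Open Scope quotient_scope.

(** A linearly independent family of greatest length spans. *)
Lemma bounded_dimension (k : fieldType) (V : lmodType k) (D : nat) :
    (forall b : 'I_D.+1 -> V, ~ lin_indep b) ->
  exists2 d, (d <= D)%N & has_dim V d.
Proof.
move=> noD; pose P d := `[< exists b : 'I_d -> V, lin_indep b >].
have exP : exists d, P d.
  by exists 0%N; apply/asboolP; exists (fun _ => 0) => c _ [].
have leP d : P d -> (d <= D)%N.
  move=> /asboolP[b bfree]; rewrite leqNgt; apply/negP => lt_Dd.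
  apply: (noD (fun i => b (widen_ord lt_Dd i))) => c c0.
  pose c' (i : 'I_d) := if insub (val i) is Some j then c j else 0.
  have c'w i : c' (widen_ord lt_Dd i) = c i by rewrite /c' /= valK.
  suff c'0 : forall i, c' i = 0 by move=> i; rewrite -c'w.
  apply: bfree; rewrite -[RHS]c0.
  rewrite (bigID (fun i : 'I_d => (i < D.+1)%N)) /= addrC big1 ?add0r.
    rewrite (reindex_onto (widen_ord lt_Dd) (fun i => inord i)) /=.
      apply: eq_big => [i|i _]; last by rewrite c'w.
      by rewrite ltn_ord /=; apply/eqP/val_inj; rewrite /= inordK.
    by move=> i lti; apply: val_inj; rewrite /= inordK.
  by move=> i nlti; rewrite /c' insubF ?scale0r //; apply/negbTE.
case: (ex_maxnP exP leP) => d Pd maxd; exists d; first exact: leP.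
move/asboolP: Pd => [b bfree]; exists b; split=> // v.
pose b' i := if unlift ord0 i is Some j then b j else v.
have [c [c0 cb']] : exists c : 'I_d.+1 -> k,
    (exists i, c i != 0) /\ \sum_i c i *: b' i = 0.
  apply: contrapT => nc; suff : P d.+1 by move/maxd; rewrite ltnn.
  apply/asboolP; exists b' => c cb' i; apply/eqP; apply: contrapT => /negP ci.
  by apply: nc; exists c; split=> //; exists i.
move: cb'; rewrite big_ord_recl /b' unlift_none.
under eq_bigr => i _ do rewrite liftK.
have [c00|c00] := eqVneq (c ord0) 0.
  rewrite c00 scale0r add0r => /bfree cl0; case: c0 => i.
  by have [j ->|->] := unliftP ord0 i; rewrite ?cl0 ?c00 eqxx.
move=> /eqP; rewrite addr_eq0 => /eqP cv.
exists (fun i => - ((c ord0)^-1 * c (lift ord0 i))).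
rewrite -[v](scalerK c00) cv scalerN scaler_sumr -sumrN.
by apply: eq_bigr => i _; rewrite scalerA scaleNr.
Qed.

(** Divide a relation over [K] by its coefficient of least value and replace the
    quotients by their residues, one of which is 1: the error terms are products
    of the [f i] with elements of the maximal ideal. *)
Lemma residual_relation (k K F : fieldType) (iota : {rmorphism k -> K})
    (psi : {rmorphism K -> F}) (N : nat)
    (W : valuation_ring K) (O : valuation_ring F) :
    (forall x, (psi x \in O) = (x \in W)) ->
    (forall x, x \in W -> exists a, x - iota a \in vmax W) ->
    finite_rank psi N ->
  forall (f : 'I_N.+1 -> F) (g : F), (forall i, f i / g \in O) ->
  exists2 a : 'I_N.+1 -> k, exists i, a i != 0 &
    (\sum_i psi (iota (a i)) * f i) / g \in vmax O.
Proof.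
move=> OW resW rkN f g fO; have [c [i0 ci0] c0] := rkN f.
have [j cj cO] := least_value W ci0.
have /choice[a aP] : forall i, exists a, c i / c j - iota a \in vmax W.
  by move=> i; exact: resW.
have psi_max x : x \in vmax W -> psi x \in vmax O.
  by rewrite !vmaxE fmorph_eq0 -fmorphV OW.
exists a.
  exists j; have := aP j; rewrite divff //; apply: contraL => /eqP ->.
  by rewrite rmorph0 subr0 vmax1.
rewrite (_ : \sum_i _ = - \sum_i psi (c i / c j - iota (a i)) * f i).
  rewrite mulNr rpredN mulr_suml; apply: rpred_sum => i _.
  by rewrite -mulrA mulrC; apply: vmaxM => //; exact: psi_max.
apply/eqP; rewrite -addr_eq0 -big_split /=.
rewrite (eq_bigr (fun i => (psi (c j))^-1 * (psi (c i) * f i))) => [|i _].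
  by rewrite -mulr_sumr c0 mulr0.
by rewrite rmorphB fmorph_div /=; ring.
Qed.

(** A family in the leaf lifts to elements that all have value [n], unless one
    of its members is zero, which is itself a relation. *)
Lemma leaf_dependent (k : fieldType) (R : domainAlgType k) (r N : nat)
    (o : group_order r) (mu : valuation {fraction R} o)
    (mu_k : trivial_on_scalars mu) (n : 'rV[int]_r) :
    (forall f : 'I_N.+1 -> {fraction R}, (forall i, f i != 0 /\ mu (f i) = n) ->
      exists2 c : 'I_N.+1 -> k, exists i, c i != 0 &
        \sum_i c i *: f i \in Kgt n mu_k) ->
  forall b : 'I_N.+1 -> leaf mu_k n, ~ lin_indep b.
Proof.
move=> dep b bfree.
have /choice[f bE] : forall i, exists f : Kspace mu_k n,
    b i = \pi_(leaf mu_k n) f.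
  by move=> i; have [f] := lmod_quotP (b i); exists f.
suff [c [i /eqP ci] cf] : exists2 c : 'I_N.+1 -> k, exists i, c i != 0 &
    \sum_i c i *: f i \in @Kspace_gt k R r o mu mu_k n.
  apply: ci; apply: bfree.
  have -> : \sum_i c i *: b i = \pi_(leaf mu_k n) (\sum_i c i *: f i).
    by rewrite raddf_sum; apply: eq_bigr => j _; rewrite bE -[RHS]pi_scale.
  rewrite -[RHS](raddf0 (\pi_(leaf mu_k n))); apply/eqP.
  by rewrite -[_ == _]Quotient.idealrBE subr0.
have KeltE c : Kelt (\sum_i c i *: f i) = \sum_i c i *: Kelt (f i).
  rewrite -[LHS]/(val _) raddf_sum; apply: eq_bigr => j _.
  exact: linearZ.
have [[i fi]|nf] := EM (exists i, f i \in @Kspace_gt k R r o mu mu_k n).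
  exists (fun j => (j == i)%:R); first by exists i; rewrite eqxx oner_eq0.
  rewrite (bigD1 i) //= eqxx scale1r big1 ?addr0 // => j /negPf->.
  by rewrite scale0r.
have [i|c c0 cf] := dep (fun i => Kelt (f i)).
  have nfi : Kelt (f i) \notin Kgt n mu_k.
    by apply/negP => fi; apply: nf; exists i.
  move: (Kelt_in (f i)) nfi; rewrite !unfold_in negb_or => + /andP[f0 /negPf].
  rewrite (negPf f0) /= => nfi /negbT.
  by rewrite /olt nfi andbT negbK => /eqP.
by exists c => //; rewrite unfold_in KeltE.
Qed.

Theorem proposition3p13 (k : fieldType) (R : domainAlgType k) (r : nat)
    (R_fg : finitely_generated R) (R_trdeg : has_trdeg {fraction R} r) :
  exists (o : group_order r) (nu : valuation {fraction R} o)
         (nu_k : trivial_on_scalars nu),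
    faithful nu /\ bounded_leaves nu_k.
Proof.
have [[z zfree] z_max] := R_trdeg.
pose phi : {rmorphism {mpoly k[r]} -> {fraction R}} :=
  mmap (in_alg {fraction R}) z.
have phi_inj : injective phi.
  move=> p q pq; apply/eqP; rewrite -subr_eq0; apply/eqP/zfree.
  by rewrite -/(phi _) rmorphB pq subrr.
have [psi psiE] := fraction_lift phi_inj.
have alg a : algebraicOver psi a.
  apply: (transcendence_basis_algebraic psiE) => y /z_max.
  by rewrite ltnn.
have [N rkN] := finitely_generated_finite_rank R_fg psiE alg.
have [W [v [vM v0 v_surj Wk resW]]] := monomial_valuation k r.
have [O [nu [OW nuM nu0 nu_surj]]] := value_map_extension rkN vM v0 v_surj.
have [o [mu [mu_nu muE]]] := valuation_of_ring nuM nu0 nu_surj.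
pose iota : {rmorphism k -> {fraction {mpoly k[r]}}} :=
  @tofrac _ \o @mpolyC r k.
have scalarE a : a%:A = psi (iota a).
  by rewrite /= psiE -[RHS]/(mmap _ _ _) mmapC.
have mu_k : trivial_on_scalars mu.
  move=> a a0; rewrite mu_nu; apply/eqP.
  by rewrite scalarE nu0 ?fmorph_eq0 // vunitE -!fmorphV !OW !Wk.
exists o, mu, mu_k; split=> [n|].
  by have [f f0 fn] := nu_surj n; exists f; rewrite // mu_nu.
exists N => n; apply: bounded_dimension; apply: leaf_dependent => f fP.
have [g g0 gn] := nu_surj n.
have [i|c c0 cf] :=
  residual_relation (iota := iota) OW resW rkN (f := f) (g := g).
  have [fi0 fin] := fP i.
  by rewrite -muE // gn -mu_nu fin; exact: ole_refl.
exists c => //.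
rewrite (eq_bigr (fun i => psi (iota (c i)) * f i)) => [|i _]; last first.
  by rewrite -scalarE -scalerAl mul1r.
rewrite unfold_in; set s := \sum_i _ in cf *.
have [//|s0 /=] := eqVneq s 0.
have sg0 : s / g != 0 by rewrite mulf_neq0 ?invr_eq0.
have sgO := vmax_vring cf.
move: cf; rewrite vmaxE (negPf sg0) invf_div /= => gsO.
rewrite /olt mu_nu -gn muE // sgO andbT.
by apply: contraNneq gsO => gs; rewrite -muE // gs; exact: ole_refl.
Qed.
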